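(* Consider the following search problem. An unknown multiset $S$ of $k$ integers, each in $\{1,\dots,n\}$, is fixed. An algorithm repeatedly chooses a query $Y\in\{1,\dots,n\}$ (possibly adaptively and with randomness, depending on previous answers); each time, an element $X$ of $S$ is selected uniformly at random, independently of everything else, and the algorithm is told only whether $X\le Y$ or $X>Y$. At the end the algorithm outputs a multiset, and it is required that for every multiset $S$ the output equals $S$ with probability at least $1-\delta$. Then, for an error parameter $\delta$ with $n^{-O(1)}<\delta<1/4$, the number of queries needed to determine $S$ is $\Theta(k^3\log n)$ when $k\le n$, and $\Theta(k^2 n\log n)$ when $k\ge n$. (The constants in $\Theta(\cdot)$ may depend on the constant $\beta$ for which $\delta\ge n^{-\beta}$.)
   Context: Queries are the only cost measure. The lower bound is meant for algorithms achieving the success guarantee; the upper bound is achieved by an algorithm achieving error at most $\delta$. *)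

(* Defs.v *)
From HB Require Import structures.
From mathcomp Require Import all_boot all_order all_algebra.
From mathcomp Require Import finmap multiset.
From mathcomp Require Import all_classical all_reals all_analysis.
Set Implicit Arguments.
Unset Strict Implicit.
Unset Printing Implicit Defensive.
Import Order.TTheory GRing.Theory Num.Theory.
Local Open Scope classical_set_scope.
Local Open Scope mset_scope.
Local Open Scope ring_scope.

(* The integers 1, ..., n are encoded by 'I_n, the ordinal i standing for
   i + 1; only their order matters. *)

(* Deterministic adaptive algorithms, as decision trees; leaves may sit at
   different depths, so an algorithm may stop early. In [Query y le gt] the
   algorithm goes on with [le] if told X <= y and with [gt] if told X > y. *)
Inductive strategy (n : nat) : Type :=
| Output of {mset 'I_n}
| Query of 'I_n & strategy n & strategy n.

Fixpoint queries (n : nat) (t : strategy n) : nat :=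
  match t with
  | Output _ => 0%N
  | Query _ le gt => (maxn (queries le) (queries gt)).+1
  end.

(* Probability that [t], run on the hidden multiset [S], outputs [T]. At each
   query a fresh X is drawn uniformly from [S] (with multiplicity: the big sum
   ranges over the enumeration of [S] with repetitions). *)
Fixpoint output_prob (R : realType) (n : nat) (S : {mset 'I_n})
    (t : strategy n) (T : {mset 'I_n}) : R :=
  match t with
  | Output U => (U == T)%:R
  | Query y le gt =>
      (\sum_(x <- S)
         (if (x <= y)%N then output_prob R S le T else output_prob R S gt T))
      / (size S)%:R
  end.

(* A randomized algorithm draws a seed from an arbitrary probability space,
   independently of the answers, and then follows the deterministic strategy
   attached to it. Since [strategy n] is countable, measurability of the fibres
   is measurability for the discrete sigma-algebra. *)
Record randomized_algorithm (R : realType) (n : nat) := RandomizedAlgorithm {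
  seed_display : measure_display;
  seed : measurableType seed_display;
  seed_law : probability seed R;
  strategy_of : seed -> strategy n;
  measurable_strategy_of :
    forall t : strategy n, measurable (strategy_of @^-1` [set t])
}.

Arguments strategy_of {R n} A w : rename.

Definition success_prob (R : realType) (n : nat)
    (A : randomized_algorithm R n) (S : {mset 'I_n}) : \bar R :=
  \int[seed_law A]_w (output_prob R S (strategy_of A w) S)%:E.

Definition identifies (R : realType) (n k : nat) (delta : R)
    (A : randomized_algorithm R n) : Prop :=
  forall S : {mset 'I_n}, size S = k ->
    ((1 - delta)%:E <= success_prob A S)%E.

(* Worst-case cost: over all seeds and all answers. *)
Definition uses_at_most (R : realType) (n : nat)
    (A : randomized_algorithm R n) (q : nat) : Prop :=
  forall w : seed A, (queries (strategy_of A w) <= q)%N.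

Definition solvable_with (R : realType) (n k : nat) (delta : R) (q : nat)
    : Prop :=
  exists A : randomized_algorithm R n,
    identifies k delta A /\ uses_at_most A q.

Definition is_query_complexity (R : realType) (n k : nat) (delta : R) (q : nat)
    : Prop :=
  solvable_with n k delta q /\
  forall q' : nat, solvable_with n k delta q' -> (q <= q')%N.

(* Main.v *)
(** Lower bound (k >= 4).  Put about k/2 elements at the bottom and at least k/4
at the top, cut {1, ..., n} into m = min(k/4, n/2) blocks of size r + 1 = n/m and
place one element freely in each block.  Moving one free element changes only
the answers to queries in its block, and those by a probability 1/k, so by the
chi-square bound a query costs divergence O(1/k^2) towards each of r neighbours.
The Donsker-Varadhan inequality with test function [s * 1(output = S)] gives,
for each of the N = m r neighbours S' of S,
   (e^s - 1) P_S'(output = S) >= s P_S(output = S) - KL(P_S, P_S').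
Averaged over S and summed over the neighbours, the left side is at most
(e^s - 1)/4; the choice e^s = 1 + N yields q = Omega(m k^2 log N).  For k < 4, counting
the leaves of the decision tree suffices.

Upper bound.  For k <= n, find each order statistic by a multiplicative-weights
binary search: each round multiplies the expected odds against the true position
by at most 1 - 1/(4 k^2), so O(k^2 log n) queries make the odds less than
delta / k, and Markov's inequality bounds the error.  For k >= n, estimate the number of
elements <= y for each y from O(k^2 log n) samples, by an exponential-moment
bound. *)

Require Import Defs.
From HB Require Import structures.
From mathcomp Require Import all_boot all_order all_algebra.
From mathcomp Require Import finmap multiset ring lra zify.
From mathcomp Require Import all_classical all_reals all_analysis.
From mathcomp Require Import measurable_realfun.
Set Implicit Arguments.
Unset Strict Implicit.
Unset Printing Implicit Defensive.
Import Order.TTheory GRing.Theory Num.Theory.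
Local Open Scope classical_set_scope.
Local Open Scope mset_scope.
Local Open Scope ring_scope.

(** * Output probabilities and randomization *)

Section OutputProbability.
Variables (R : realType) (n : nat).
Implicit Types (S T : {mset 'I_n}) (t : strategy n).

(** Strict thresholds in [nat] cover both sides of a value: [s = y.+1] is the event X <= y and
    [s = y] is the event X < y. *)
Definition count_below S (s : nat) : nat := count (fun x : 'I_n => x < s)%N S.

Definition freq S (s : nat) : R := (count_below S s)%:R / (size S)%:R.

Lemma freq_ge0 S s : 0 <= freq S s.
Proof. by rewrite divr_ge0. Qed.

Lemma freq_le1 S s : (0 < size S)%N -> freq S s <= 1.
Proof. by move=> S0; rewrite ler_pdivrMr ?ltr0n// mul1r ler_nat count_size. Qed.

Lemma output_prob_query S T y le gt : (0 < size S)%N ->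
  output_prob R S (Query y le gt) T =
  freq S y.+1 * output_prob R S le T + (1 - freq S y.+1) * output_prob R S gt T.
Proof.
move=> S0 /=; have S0' : (size S)%:R != 0 :> R by rewrite pnatr_eq0 -lt0n.
have E (s : seq 'I_n) a b : \sum_(x <- s) (if (x <= y)%N then a else b) =
    (count (fun x : 'I_n => x < y.+1)%N s)%:R * a
    + ((size s)%:R - (count (fun x : 'I_n => x < y.+1)%N s)%:R) * b :> R.
  elim: s => [|x s IH]; first by rewrite big_nil /=; ring.
  rewrite big_cons IH /= ltnS; case: (x <= y)%N => /=; rewrite -?natr1 ?natrD; ring.
by rewrite E /freq /count_below; field.
Qed.

Lemma output_prob_ge0 S t T : 0 <= output_prob R S t T.
Proof.
elim: t => [U|y le IHl gt IHg] /=; first by case: eqP.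
by rewrite divr_ge0// sumr_ge0// => x _; case: ifP.
Qed.

Lemma sum_output_prob_le1 S t (Ts : seq {mset 'I_n}) :
  (0 < size S)%N -> uniq Ts -> \sum_(T <- Ts) output_prob R S t T <= 1.
Proof.
move=> S0 uTs; elim: t => [U|y le IHl gt IHg].
  rewrite /= -natr_sum -[leRHS]/(1%:R) ler_nat.
  under eq_bigr do rewrite eq_sym.
  have -> : (\sum_(T <- Ts) (T == U) = count_mem U Ts)%N.
    by rewrite -sum1_count [RHS]big_mkcond; apply: eq_bigr => T _ /=; case: eqP.
  by rewrite count_uniq_mem ?leq_b1.
under eq_bigr do rewrite output_prob_query//.
rewrite big_split/= -!mulr_sumr.
have := freq_ge0 S y.+1; have := freq_le1 y.+1 S0; nra.
Qed.

Lemma output_prob_le1 S t T : (0 < size S)%N -> output_prob R S t T <= 1.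
Proof. by move=> S0; have := @sum_output_prob_le1 S t [:: T] S0 isT; rewrite big_seq1. Qed.

End OutputProbability.


(** * Reduction of randomized algorithms to deterministic strategies *)

Section Randomization.
Variables (R : realType) (n : nat).

(** Trees over a countable type are countable, so an injection into them makes the set of strategies
    countable; an output is coded by its multiplicities. *)
Fixpoint strategy_code (t : strategy n) :
    GenTree.tree ({ffun 'I_n -> nat} + 'I_n)%type :=
  match t with
  | Output U => GenTree.Leaf (inl [ffun i => U i])
  | Query y le gt =>
      GenTree.Node 0 [:: GenTree.Leaf (inr y); strategy_code le; strategy_code gt]
  end.

Lemma strategy_code_inj : injective strategy_code.
Proof.
elim=> [U|y le IHl gt IHg] [U'|y' le' gt'] //= [].
  by move=> /ffunP e; congr Output; apply/msetP => i; have := e i; rewrite !ffunE.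
by move=> -> /IHl -> /IHg ->.
Qed.

(** The preimage is a countable union over codes, and each piece is either empty or a single fibre
    of [strategy_of A]. *)
Lemma measurable_strategy (A : randomized_algorithm R n) (f : strategy n -> \bar R) :
  measurable_fun [set: seed A] (fun w => f (strategy_of A w)).
Proof.
move=> _ Y mY; rewrite setTI.
pose F c := [set w : seed A | choice.pickle (strategy_code (strategy_of A w)) = c
                             /\ Y (f (strategy_of A w))].
have -> : (fun w => f (strategy_of A w)) @^-1` Y = \bigcup_c F c.
  apply/seteqP; split => [w Yw|w [c _ [_ //]]].
  by exists (choice.pickle (strategy_code (strategy_of A w))).
apply: bigcup_measurable => c _.
have [[w [wc Yw]]|F0] := pselect (exists w, F c w); last first.
  rewrite (_ : F c = set0) //; apply/seteqP; split=> // w Fw.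
  by exfalso; apply: F0; exists w.
rewrite (_ : F c = strategy_of A @^-1` [set strategy_of A w]).
  exact: measurable_strategy_of.
apply/seteqP; split=> v /=.
  by case=> vc _; apply/strategy_code_inj/(pcan_inj choice.pickleK); rewrite vc wc.
by rewrite /F/= => ->.
Qed.

(** Averaging step of Yao's principle: after exchanging the sum over [Z] with the integral over
    seeds, some seed must reach 3/4, because the mean success exceeds it. *)
Lemma exists_good_strategy (k : nat) (delta : R) (A : randomized_algorithm R n)
    (Z : finType) (Sz : Z -> {mset 'I_n}) :
  (0 < #|Z|)%N -> (forall z, size (Sz z) = k) -> delta < 1 / 4 ->
  identifies k delta A ->
  exists w, 3 / 4 * #|Z|%:R <= \sum_z output_prob R (Sz z) (strategy_of A w) (Sz z).
Proof.
move=> Z0 szS d4 idA; apply: contrapT => /forallNP H.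
pose f z w := (output_prob R (Sz z) (strategy_of A w) (Sz z))%:E.
have f0 z w : (0 <= f z w)%E by rewrite lee_fin output_prob_ge0.
have le1 : (\sum_z \int[seed_law A]_w f z w <= (3 / 4 * #|Z|%:R)%:E)%E.
  rewrite -ge0_integral_sum //; last first.
    move=> z; exact: (measurable_strategy (fun t => (output_prob R (Sz z) t (Sz z))%:E)).
  have -> : ((3 / 4 * #|Z|%:R)%R%:E = \int[seed_law A]_w (cst (3 / 4 * #|Z|%:R)%R%:E w))%E.
    by rewrite integral_cst//= probability_setT mule1.
  apply: ge0_le_integral => //.
  - by move=> w _; exact: sume_ge0.
  - apply: emeasurable_sum => z; exact: (measurable_strategy (fun t => (output_prob R (Sz z) t (Sz z))%:E)).
  - by move=> w _; rewrite sumEFin lee_fin ltW// ltNge; apply/negP/H.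
have : ((3 / 4 * #|Z|%:R)%:E < \sum_z \int[seed_law A]_w f z w)%E.
  apply: (@lt_le_trans _ _ (\sum_(z : Z) (1 - delta)%:E)%E).
    rewrite sumEFin lte_fin sumr_const -[ltRHS]mulr_natr ltr_pM2r ?ltr0n//; lra.
  by apply: lee_sum => z _; exact: idA.
by rewrite ltNge le1.
Qed.

End Randomization.

Lemma deterministic_solvable (R : realType) (n k : nat) (delta : R) (t : strategy n) :
  (forall S : {mset 'I_n}, size S = k -> 1 - output_prob R S t S <= delta) ->
  solvable_with n k delta (queries t).
Proof.
move=> H.
have m (t' : strategy n) : measurable ((fun _ : unit => t) @^-1` [set t']).
  by [].
exists (@RandomizedAlgorithm R n _ unit (dirac tt : probability unit R) (fun _ => t) m).
split; last by [].
move=> S /H HS; rewrite /success_prob/=.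
rewrite (_ : (\int[_]_w _ = \int[(dirac tt : probability unit R)]_w (cst (output_prob R S t S)%:E w))%E) //.
by rewrite integral_cst//= probability_setT mule1 lee_fin; lra.
Qed.

Lemma is_query_complexity_exists (R : realType) (n k : nat) (delta : R) (q : nat) :
  solvable_with n k delta q ->
  exists2 q', is_query_complexity n k delta q' & (q' <= q)%N.
Proof.
move=> sq; have [q' q'P] : exists q', is_query_complexity n k delta q'.
  have ex : exists q, `[< solvable_with n k delta q >] by exists q; exact/asboolP.
  exists (ex_minn ex); case: ex_minnP => m /asboolP sm mmin.
  by split => // q' /asboolP; exact: mmin.
by exists q' => //; case: q'P => _; exact.
Qed.

(** * Lower bound *)

Section ChangeOfMeasure.
Variables (R : realType) (n : nat).
Implicit Types (S T : {mset 'I_n}) (t : strategy n) (d : 'I_n -> R).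

(** This follows the chain rule for Kullback-Leibler divergence: it is the expected total cost [d]
    of the queries made under [S]. *)
Fixpoint divergence S d t : R :=
  match t with
  | Output _ => 0
  | Query y le gt => d y + freq R S y.+1 * divergence S d le
                         + (1 - freq R S y.+1) * divergence S d gt
  end.

(** The quotient (p - p')^2 / (p' (1 - p')) is the chi-square divergence of two Bernoulli laws, an
    upper bound for their Kullback-Leibler divergence. *)
Definition chi2_bound S S' d : Prop := forall y : 'I_n,
  let p := freq R S y.+1 in let p' := freq R S' y.+1 in
  (p = p' /\ 0 <= d y) \/
  [/\ 0 < p < 1, 0 < p' < 1 & (p - p') ^+ 2 <= d y * (p' * (1 - p'))].

Lemma ln_ge1BV (x : R) : 0 < x -> 1 - x^-1 <= ln x.
Proof.
move=> x0; have /le_ln1Dx : -1 < x^-1 - 1 by rewrite ltrBrDr addNr invr_gt0.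
by rewrite addrC subrK lnV ?posrE//; lra.
Qed.

(* [l] is the likelihood ratio accumulated on the path to [t]. *)
Lemma tree_donsker_varadhan S S' T d (s : R) t (l : R) :
  (0 < size S)%N -> (0 < size S')%N -> chi2_bound S S' d -> 0 < l ->
  1 + s * output_prob R S t T + ln l - divergence S d t <=
  l * (expR s * output_prob R S' t T + (1 - output_prob R S' t T)).
Proof.
move=> S0 S0' dP; elim: t l => [U|y le IHl gt IHg] l l0.
  (* At a leaf both cases are e^x >= 1 + x, with x = s + ln l if the output is [T] and x = ln l
     otherwise. *)
  rewrite /=; case: eqP => _; rewrite ?mulr1n ?mulr0n.
    have := @expR_ge1Dx R (s + ln l); rewrite expRD lnK ?posrE//; lra.
  have := @expR_ge1Dx R (ln l); rewrite lnK ?posrE//; lra.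
rewrite !output_prob_query//=; case: (dP y) => /=; set p := freq R S _; set p' := freq R S' _.
  move=> [<-] d0; have := freq_ge0 R S y.+1; have := @freq_le1 R n S y.+1 S0.
  rewrite -/p => p1 p0.
  have hl := ler_wpM2l p0 (IHl l l0).
  have hg : (1 - p) * _ <= (1 - p) * _ := ler_wpM2l _ (IHg l l0).
  by have := hg ltac:(lra); nra.
move=> [/andP[p0 p1] /andP[q0 q1] pd].
have r0 : 0 < 1 - p by lra. have r0' : 0 < 1 - p' by lra.
(* An answer multiplies the likelihood ratio by p' / p or (1 - p') / (1 - p); ln x >= 1 - 1/x bounds
   the mean change of its logarithm by a chi-square term. *)
have l1 : 0 < l * (p' / p) by rewrite mulr_gt0// divr_gt0.
have l2 : 0 < l * ((1 - p') / (1 - p)) by rewrite mulr_gt0// divr_gt0.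
have := ler_wpM2l (ltW p0) (IHl _ l1); have := ler_wpM2l (ltW r0) (IHg _ l2).
have lnD (u : R) : 0 < u -> ln (l * u) = ln l + ln u by move=> u0; rewrite lnM ?posrE.
rewrite (lnD _ (divr_gt0 q0 p0)) (lnD _ (divr_gt0 r0' r0)).
have := ler_wpM2l (ltW p0) (ln_ge1BV (divr_gt0 q0 p0)).
have := ler_wpM2l (ltW r0) (ln_ge1BV (divr_gt0 r0' r0)).
have -> : p * (1 - (p' / p)^-1) = p - p ^+ 2 / p' by field; rewrite !gt_eqF.
have -> : (1 - p) * (1 - ((1 - p') / (1 - p))^-1) = (1 - p) - (1 - p) ^+ 2 / (1 - p').
  by field; rewrite !gt_eqF.
have dy : p ^+ 2 / p' + (1 - p) ^+ 2 / (1 - p') <= 1 + d y.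
  have -> : p ^+ 2 / p' + (1 - p) ^+ 2 / (1 - p') = 1 + (p - p') ^+ 2 / (p' * (1 - p')).
    by field; rewrite !gt_eqF.
  by rewrite lerD2l ler_pdivrMr// mulr_gt0.
set X := expR s * output_prob R S' le T + _; set Y := expR s * output_prob R S' gt T + _.
have -> : p * (l * (p' / p) * X) = l * p' * X by field; rewrite gt_eqF.
have -> : (1 - p) * (l * ((1 - p') / (1 - p)) * Y) = l * (1 - p') * Y by field; rewrite gt_eqF.
rewrite /X /Y; move: dy; lra.
Qed.

(** All these divergences are expectations under the same [S], so at each node the costs add up over
    [i] to at most [D], and a path has at most [queries t] nodes. *)
Lemma sum_divergence_le (I : finType) S (d : I -> 'I_n -> R) (D : R) t :
  (0 < size S)%N -> 0 <= D -> (forall y, \sum_i d i y <= D) ->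
  \sum_i divergence S (d i) t <= (queries t)%:R * D.
Proof.
move=> S0 D0 dD; elim: t => [U|y le IHl gt IHg] /=; first by rewrite big1// mul0r.
rewrite !big_split/= -!mulr_sumr.
have := freq_ge0 R S y.+1; have := @freq_le1 R n S y.+1 S0; set p := freq _ _ _ => p1 p0.
have hm (a b : nat) : (a <= b)%N -> a%:R * D <= b%:R * D by move=> ab; rewrite ler_wpM2r// ler_nat.
set M := (maxn (queries le) (queries gt))%:R * D.
have -> : (maxn (queries le) (queries gt)).+1%:R * D = M + D by rewrite -natr1 mulrDl mul1r.
have H1 : \sum_i divergence S (d i) le <= M by apply: le_trans IHl _; exact/hm/leq_maxl.
have H2 : \sum_i divergence S (d i) gt <= M by apply: le_trans IHg _; exact/hm/leq_maxr.
have := dD y; nra.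
Qed.

End ChangeOfMeasure.

(** The neighbours of [z] are the [sigma i z]. As each [sigma i] is a bijection, wrong outputs at
    neighbours can be reindexed as wrong outputs at [z] itself, where distinct outputs have total
    probability at most 1. *)
Lemma shift_lower_bound (R : realType) (n : nat) (Z I : finType)
    (S : Z -> {mset 'I_n}) (sigma tau : I -> Z -> Z) (d : I -> 'I_n -> R) (D : R)
    (t : strategy n) :
  (0 < #|Z|)%N -> (0 < #|I|)%N -> injective S -> (forall z, 0 < size (S z))%N ->
  (forall i, cancel (sigma i) (tau i)) -> (forall i, cancel (tau i) (sigma i)) ->
  (forall z, injective (tau^~ z)) -> (forall i z, tau i z != z) ->
  (forall i z, chi2_bound (S z) (S (sigma i z)) (d i)) ->
  0 <= D -> (forall y, \sum_i d i y <= D) ->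
  3 / 4 * #|Z|%:R <= \sum_z output_prob R (S z) t (S z) ->
  #|I|%:R * ln (1 + #|I|%:R) <= 4 * ((queries t)%:R * D).
Proof.
move=> Z0 I0 Sinj S0 st ts tinj tneq chi D0 dD succ.
set N := #|I|%:R; have N1 : 1 <= N by rewrite ler1n.
have N1gt : 0 < 1 + N by lra.
(* This choice makes the factor e^s - 1 equal to the number N of neighbours. *)
pose s := ln (1 + N).
have es : expR s = 1 + N by rewrite lnK ?posrE.
have s_half : 1 / 2 <= s.
  have := @ln_ge1BV R (1 + N) N1gt; rewrite -/s.
  have : (1 + N)^-1 <= 2^-1 by rewrite lef_pV2 ?posrE//; lra.
  lra.
pose p z T := output_prob R (S z) t T.
have wrong : \sum_z \sum_i p (sigma i z) (S z) <= #|Z|%:R - \sum_z p z (S z).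
  rewrite exchange_big/=.
  have -> : \sum_i \sum_z p (sigma i z) (S z) = \sum_z \sum_i p z (S (tau i z)).
    rewrite [RHS]exchange_big/=; apply: eq_bigr => i _.
    rewrite (reindex_onto (tau i) (sigma i)) => [|z _]; last exact: st.
    by under eq_bigl do rewrite ts eqxx; under eq_bigr do rewrite ts.
  rewrite -sum1_card natr_sum -sumrB; apply: ler_sum => z _.
  rewrite lerBrDr addrC.
  have := @sum_output_prob_le1 R n (S z) t (S z :: [seq S (tau i z) | i <- enum I]) (S0 z).
  rewrite big_cons big_map big_enum/=; apply; apply/andP; split.
    apply/mapP => -[i _ /Sinj zE]; by have := tneq i z; rewrite -zE eqxx.
  by rewrite map_inj_uniq ?enum_uniq// => i j /Sinj /tinj.
have dv i z : s * p z (S z) - divergence (S z) (d i) t <= N * p (sigma i z) (S z).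
  have := tree_donsker_varadhan (S z) s t (S0 z) (S0 (sigma i z)) (chi i z) (ltr01).
  rewrite ln1 es /p; lra.
have : \sum_z \sum_i (s * p z (S z) - divergence (S z) (d i) t)
    <= N * (\sum_z \sum_i p (sigma i z) (S z)).
  by rewrite mulr_sumr; apply: ler_sum => z _; rewrite mulr_sumr; exact: ler_sum.
have -> : \sum_z \sum_i (s * p z (S z) - divergence (S z) (d i) t) =
    N * s * (\sum_z p z (S z)) - \sum_z \sum_i divergence (S z) (d i) t.
  rewrite mulr_sumr -sumrB; apply: eq_bigr => z _.
  by rewrite sumrB sumr_const -mulr_natl mulrA.
have kl : \sum_z \sum_i divergence (S z) (d i) t <= #|Z|%:R * ((queries t)%:R * D).
  apply: (le_trans (ler_sum _ (fun z _ => sum_divergence_le t (S0 z) D0 dD))).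
  by rewrite sumr_const -[leLHS]mulr_natl.
have Zp : 0 < #|Z|%:R :> R by rewrite ltr0n.
move: kl wrong succ; rewrite -/(p _ _).
set K := _ * D; set P := \sum_z p z (S z); set W := \sum_z \sum_i p _ _; set G := \sum_z _.
set c := #|Z|%:R => kl wrong succ main.
have succ' : 3 / 4 * c <= P by [].
(* After division by #|Z| there remains 3/4 N s <= N/4 + (queries t) D, and s >= 1/2 absorbs N/4
   into N s / 2. *)
have h1 : N * W <= N * (c / 4) by apply: ler_wpM2l; lra.
have h2 : N * s * (3 / 4 * c) <= N * s * P by apply: ler_wpM2l => //; nra.
have : c * (N * s * (3 / 4)) <= c * (N / 4 + K) by nra.
rewrite ler_pM2l// => h3.
have : N * (1 / 2) <= N * s by apply: ler_wpM2l; lra.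
rewrite -/s; nra.
Qed.

(** A leaf is correct for at most one [z]; bounding both branch probabilities by 1 then counts the
    leaves. *)
Lemma counting_lower_bound (R : realType) (n : nat) (Z : finType)
    (S : Z -> {mset 'I_n}) (t : strategy n) :
  injective S -> (forall z, 0 < size (S z))%N ->
  \sum_z output_prob R (S z) t (S z) <= 2 ^+ queries t.
Proof.
move=> Sinj S0; elim: t => [U|y le IHl gt IHg] /=.
  rewrite -natr_sum -[leRHS]/(1%:R) ler_nat.
  have [/existsP[z0 /eqP E]|/existsPn H] := boolP [exists z, U == S z].
    rewrite (bigD1 z0)//= big1 ?addn0 ?leq_b1// => z zz0.
    by rewrite E (inj_eq Sinj) eq_sym (negbTE zz0).
  by rewrite big1// => z _; rewrite (negbTE (H z)).
have H : \sum_z output_prob R (S z) (Query y le gt) (S z) <=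
    \sum_z output_prob R (S z) le (S z) + \sum_z output_prob R (S z) gt (S z).
  rewrite -big_split/=; apply: ler_sum => z _.
  rewrite -/(output_prob R (S z) (Query y le gt) (S z)) output_prob_query//.
  have := freq_ge0 R (S z) y.+1; have := @freq_le1 R n (S z) y.+1 (S0 z).
  have := @output_prob_ge0 R n (S z) le (S z).
  have := @output_prob_ge0 R n (S z) gt (S z); nra.
apply: (le_trans H); rewrite exprS mulrDl mul1r lerD//.
  by apply: le_trans IHl _; rewrite ler_weXn2l ?leq_maxl// ler1n.
by apply: le_trans IHg _; rewrite ler_weXn2l ?leq_maxr// ler1n.
Qed.

(** * Hard instances with one free element per block *)

Section HardInstance.
Variables (n' m r k : nat).
Let n := n'.+1.
Let Z := {ffun 'I_m -> 'I_r.+1}.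
Let a := (k %/ 2)%N.

Definition block_element (z : Z) (j : 'I_m) : 'I_n := inord (j * r.+1 + z j).

(* The fixed elements at the bottom and at the top keep all informative answer
   probabilities in [1/4, 3/4]. *)
Definition hard_instance (z : Z) : {mset 'I_n} :=
  seq_mset (nseq a ord0 ++ [seq block_element z j | j <- enum 'I_m]
              ++ nseq (k - a - m) ord_max).

Hypotheses (mr : (m * r.+1 <= n)%N) (mk : (4 * m <= k)%N)
  (k4 : (4 <= k)%N).

Definition moved_below (z : Z) (s : nat) : nat := (\sum_(j < m) (j * r.+1 + z j < s))%N.

Lemma moved_below_le z s : (moved_below z s <= m)%N.
Proof.
rewrite -[leqRHS]card_ord -sum1_card; apply: leq_sum => j _; exact: leq_b1.
Qed.

Lemma val_block_element z j : block_element z j = (j * r.+1 + z j)%N :> nat.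
Proof.
rewrite inordK//; apply: leq_trans mr.
have := ltn_ord (z j); have := ltn_ord j; nia.
Qed.

Lemma size_hard_instance z : size (hard_instance z) = k.
Proof.
rewrite (perm_size (perm_eq_seq_mset _)) !size_cat !size_nseq size_map size_enum_ord.
rewrite /a; lia.
Qed.

Lemma count_below_hard_instance z s : count_below (hard_instance z) s =
  ((0 < s) * a + moved_below z s + (n' < s) * (k - a - m))%N.
Proof.
rewrite /count_below (permP (perm_eq_seq_mset _)) !count_cat !count_nseq count_map /= addnA.
congr (_ + _ + _)%N; rewrite -sum1_count [LHS]big_mkcond [LHS]big_enum /=.
by apply: eq_bigr => j _; rewrite val_block_element; case: ifP.
Qed.

(** Count the elements up to the free element of block [j] in [z]: the other blocks contribute
    equally for [z] and [z'], so block [j] must contribute for [z'] too. *)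
Lemma hard_instance_inj : injective hard_instance.
Proof.
have le z z' j : hard_instance z = hard_instance z' -> (z' j <= z j)%N.
  move=> E; have := count_below_hard_instance z (j * r.+1 + z j).+1.
  rewrite E count_below_hard_instance => /addIn /addnI; rewrite /moved_below.
  rewrite (bigD1 j)//= [in RHS](bigD1 j)//= ltnSn.
  rewrite (eq_bigr (fun i : 'I_m => nat_of_bool (i * r.+1 + z i < (j * r.+1 + z j).+1)%N)).
    by move=> /addIn; case: ltnP => //; lia.
  move=> i ij; congr nat_of_bool.
  have zi := ltn_ord (z i); have zi' := ltn_ord (z' i); have zj := ltn_ord (z j).
  have : (i < j \/ j < i)%N by move: ij; rewrite -val_eqE /=; lia.
  by case=> h; apply/idP/idP; nia.
by move=> z z' E; apply/ffunP => j; apply/val_inj/eqP; rewrite eqn_leq !le.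
Qed.

(** Neighbours are translates in the additive group of offsets by a nonzero amount in one
    coordinate. Offsets wrap around within a block, so subtraction inverts the move. *)
Definition shift_by (i : 'I_m * 'I_r) : Z :=
  [ffun j => if j == i.1 then lift ord0 i.2 else ord0].

(** The move changes p by at most 1/k and p' (1 - p') >= 3/16, so 16/3 rounded up to 6 suffices. *)
Definition shift_cost (R : realType) (i : 'I_m * 'I_r) (y : 'I_n) : R :=
  if (y %/ r.+1 == i.1)%N then 6 / k%:R ^+ 2 else 0.

Lemma shift_by_inj : injective shift_by.
Proof.
move=> [j d] [j' d'] /ffunP E; have := E j; rewrite !ffunE /= eqxx.
case: eqVneq => [<- /lift_inj -> //|_ /eqP].
by rewrite eq_sym (negbTE (neq_lift _ _)).
Qed.

Lemma shift_by_neq0 i : shift_by i != 0.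
Proof.
apply/eqP => /ffunP /(_ i.1); rewrite !ffunE eqxx => /eqP.
by rewrite eq_sym; apply/negP; exact: neq_lift.
Qed.

Lemma sum_shift_cost (R : realType) (y : 'I_n) :
  \sum_i shift_cost R i y <= r%:R * (6 / k%:R ^+ 2).
Proof.
have c0 : 0 <= 6 / k%:R ^+ 2 :> R by rewrite divr_ge0// exprn_ge0.
rewrite -(pair_big predT predT (fun j d => shift_cost R (j, d) y))/=.
under eq_bigr do rewrite /shift_cost /= sumr_const card_ord -[_ *+ r]mulr_natl.
rewrite -mulr_sumr ler_wpM2l//.
case: (ltnP (y %/ r.+1) m) => [h|h].
  rewrite (bigD1 (Ordinal h))//= eqxx big1 ?addr0// => j; rewrite -val_eqE/= => /negbTE.
  by rewrite eq_sym => ->.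
rewrite big1// => j _; case: eqP => // E; have := ltn_ord j; rewrite -E; lia.
Qed.

(** A query outside block [j] sees no change, and the query at the largest value is always answered
    with X <= y; only the remaining queries in block [j] can tell the two instances apart. *)
Lemma chi2_bound_shift (R : realType) (z : Z) i :
  chi2_bound (hard_instance z) (hard_instance (z + shift_by i)) (shift_cost R i).
Proof.
case: i => j d y /=; rewrite /freq !size_hard_instance !count_below_hard_instance.
set z' := z + _.
have z'E i : i != j -> z' i = z i.
  by move=> /negbTE ij; rewrite !ffunE /= ij; exact: addr0.
have k0 : 0 < k%:R :> R by rewrite ltr0n; lia.
have k20 : 0 < k%:R ^+ 2 :> R by rewrite exprn_gt0.
have c0 : 0 <= shift_cost R (j, d) y.
  by rewrite /shift_cost; case: ifP => // _; rewrite divr_ge0// ltW.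
have split w : moved_below w y.+1 =
    ((j * r.+1 + w j <= y) + \sum_(i < m | i != j) (i * r.+1 + w i < y.+1))%N.
  by rewrite /moved_below (bigD1 j).
have eqs : (\sum_(i < m | i != j) (i * r.+1 + z' i < y.+1) =
    \sum_(i < m | i != j) (i * r.+1 + z i < y.+1))%N.
  by apply: eq_bigr => i ij; rewrite z'E.
have [yj|yj] := eqVneq (y %/ r.+1)%N j; last first.
  left; split; [congr (_ %:R / _); congr (_ + _ + _)%N|by []].
  suff jy (w : Z) : (j * r.+1 + w j <= y)%N = (j < y %/ r.+1)%N by rewrite !split eqs !jy.
  have rem := ltn_pmod y (ltn0Sn r); have wj := ltn_ord (w j).
  have mono (u v : nat) : (u < v)%N -> (u * r.+1 + r.+1 <= v * r.+1)%N.
    by move=> uv; rewrite -mulSnr leq_mul2r uv orbT.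
  rewrite [in LHS](divn_eq y r.+1); move: (w j : nat) wj (mono) yj rem => {mono} c.
  move: (y %% r.+1)%N (y %/ r.+1)%N => e q cr mono qj er.
  by case: ltnP => [/mono h|]; [lia|rewrite leq_eqVlt (negbTE qj) => /mono h; lia].
have [yn|yn] := ltnP y n'; last first.
  left; split => //; congr (_ %:R / _); congr (_ + _ + _)%N.
  suff jm (w : Z) : (j * r.+1 + w j <= y)%N by rewrite !split eqs !jm.
  by rewrite -val_block_element -ltnS; apply: leq_trans (ltn_ord _) _; exact: yn.
right; rewrite ltnS ltnNge yn/= !mul1n !mul0n !addn0.
(* Lower end: floor(k/2) >= k/4. Upper end: floor(k/2) + m <= 3k/4. *)
have bnd (w : Z) : 1 / 4 <= (a + moved_below w y.+1)%:R / k%:R :> R /\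
    (a + moved_below w y.+1)%:R / k%:R <= 3 / 4 :> R.
  have := moved_below_le w y.+1; move: (moved_below _ _) => c cm.
  have h1 : (k <= 4 * (a + c))%N by rewrite /a; lia.
  have h2 : (4 * (a + c) <= 3 * k)%N by rewrite /a; lia.
  have : k%:R <= 4 * (a + c)%:R :> R by rewrite -natrM ler_nat.
  have : 4 * (a + c)%:R <= 3 * k%:R :> R by rewrite -!natrM ler_nat.
  by move=> u v; split; [rewrite ler_pdivlMr//|rewrite ler_pdivrMr//]; lra.
have [p1 p2] := bnd z; have [p'1 p'2] := bnd z'.
set p := (a + moved_below z y.+1)%:R / k%:R; rewrite -/p in p1 p2.
set p' := (a + moved_below z' y.+1)%:R / k%:R; rewrite -/p' in p'1 p'2.
split; [lra|lra|].
rewrite /shift_cost /= yj eqxx.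
have dp : (p - p') ^+ 2 <= 1 / k%:R ^+ 2.
  rewrite /p' /p -mulrBl exprMn exprVn ler_pM2r ?invr_gt0//.
  rewrite !split eqs !natrD.
  by case: (_ <= y)%N; case: (_ <= y)%N => /=; rewrite ?mulr1n ?mulr0n; nra.
have h : 3 / 16 <= p' * (1 - p') by nra.
have : 6 / k%:R ^+ 2 * (3 / 16) <= 6 / k%:R ^+ 2 * (p' * (1 - p')).
  by rewrite ler_wpM2l// divr_ge0// ltW.
have : 0 < (k%:R ^+ 2)^-1 :> R by rewrite invr_gt0.
lra.
Qed.

End HardInstance.

Lemma block_lower_bound (R : realType) (n m r k q : nat) (delta : R) :
  (0 < m)%N -> (0 < r)%N -> (m * r.+1 <= n)%N -> (4 * m <= k)%N -> (4 <= k)%N ->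
  delta < 1 / 4 -> solvable_with n k delta q ->
  m%:R * k%:R ^+ 2 * ln (1 + (m * r)%:R) <= 24 * q%:R :> R.
Proof.
case: n => [|n'] m0 r0 mr mk k4 d4; first by move: mr; rewrite leqn0 muln_eq0; lia.
move=> [A [idA useA]].
have k0 : 0 < k%:R :> R by rewrite ltr0n; lia.
have rp : 0 < r%:R :> R by rewrite ltr0n.
have szS z : size (@hard_instance n' m r k z) = k by exact: size_hard_instance.
have sz0 z : (0 < size (@hard_instance n' m r k z))%N by rewrite szS; lia.
have Z0 : (0 < #|{ffun 'I_m -> 'I_r.+1}|)%N by apply/card_gt0P; exists 0.
have [w succ] := exists_good_strategy Z0 szS d4 idA.
have D0 : 0 <= r%:R * (6 / k%:R ^+ 2) :> R by rewrite mulr_ge0// divr_ge0// exprn_ge0.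
have := @shift_lower_bound R _ {ffun 'I_m -> 'I_r.+1} ('I_m * 'I_r)%type _
  
  (fun i (z : {ffun 'I_m -> 'I_r.+1}) => z + shift_by i)
  (fun i (z : {ffun 'I_m -> 'I_r.+1}) => z - shift_by i) (@shift_cost n' m r k R)
  _ _ Z0 _ (hard_instance_inj mr mk k4) sz0 _ _ _ _ _ D0 _ succ.
rewrite card_prod !card_ord => H.
have {H} : (m * r)%:R * ln (1 + (m * r)%:R) <=
    4 * ((queries (strategy_of A w))%:R * (r%:R * (6 / k%:R ^+ 2))) :> R.
  apply: H => //.
  - by rewrite muln_gt0 m0.
  - by move=> i z; rewrite addrK.
  - by move=> i z; rewrite subrK.
  - by move=> z i j /addrI /oppr_inj /shift_by_inj.
  - by move=> i z; rewrite -subr_eq0 addrAC subrr add0r oppr_eq0 shift_by_neq0.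
  - by move=> i z; exact: chi2_bound_shift.
  - exact: sum_shift_cost.
have : (queries (strategy_of A w))%:R <= q%:R :> R by rewrite ler_nat.
set t := (queries _)%:R; set L := ln _; rewrite natrM => tq.
(* Both sides carry a factor r, which cancels: more neighbours per block only enlarge the
   logarithm. *)
have -> : m%:R * r%:R * L = r%:R * (m%:R * L) by ring.
have -> : 4 * (t * (r%:R * (6 / k%:R ^+ 2))) = r%:R * (24 * t / k%:R ^+ 2) by field; rewrite gt_eqF.
rewrite ler_pM2l// ler_pdivlMr ?exprn_gt0//; lra.
Qed.

Lemma size_seq_mset (T : choiceType) (s : seq T) : size (seq_mset s) = size s.
Proof. exact/perm_size/perm_eq_seq_mset. Qed.

Lemma ln_le_subr1 (R : realType) (x : R) : 0 < x -> ln x <= x - 1.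
Proof. by move=> x0; have := @le_ln1Dx R (x - 1); rewrite addrCA subrr addr0; apply; lra. Qed.

(** The n instances are k copies of a single value; counting gives 3/4 n <= 2^q, which excludes q =
    0 and implies n <= 4^q. *)
Lemma counting_log_lower_bound (R : realType) (n k q : nat) (delta : R) :
  (2 <= n)%N -> (0 < k)%N -> delta < 1 / 4 -> solvable_with n k delta q ->
  ln n%:R <= 2 * q%:R :> R.
Proof.
move=> n2 k0 d4 [A [idA useA]].
pose S (z : 'I_n) := seq_mset (nseq k z).
have szS z : size (S z) = k by rewrite size_seq_mset size_nseq.
have Sinj : injective S.
  move=> z z' /msetP /(_ z); rewrite !mset_seqE !count_nseq /= eqxx.
  by case: eqVneq => [->//|_]; rewrite mul0n mul1n; lia.
have Z0 : (0 < #|'I_n|)%N by rewrite card_ord; lia.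
have [w succ] := exists_good_strategy Z0 szS d4 idA.
have := counting_lower_bound R (strategy_of A w) Sinj; move=> /(_ (fun z => etrans (congr1 (leq 1) (szS z)) k0)) cnt.
have {succ cnt} : 3 / 4 * n%:R <= 2 ^+ q :> R.
  have := le_trans succ cnt; rewrite card_ord => /le_trans; apply.
  by rewrite ler_weXn2l// ler1n.
have nR : 2 <= n%:R :> R by rewrite ler_nat.
case: q {useA} => [|q] h; first by move: h; rewrite expr0; lra.
have X2 : 2 <= 2 ^+ q.+1 :> R by rewrite exprS ler_peMr// exprn_ege1// ler1n.
have : n%:R <= 2 ^+ q.+1 * 2 ^+ q.+1 :> R by nra.
have X0 : 0 < 2 ^+ q.+1 :> R by lra.
rewrite -ler_ln ?posrE ?mulr_gt0//; last by lra.
move=> /le_trans; apply; rewrite lnM ?posrE// lnXn//.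
have := @ln_le_subr1 R 2; rewrite -mulr_natr.
have : 0 <= q.+1%:R :> R by [].
move=> q0 /(_ ltac:(lra)) l2; nra.
Qed.

(** The constant is 24 * 7 * 3: 24 from the block bound, 7 from min(k, n) <= 7 m, and 3 from n <= (1
    + m r)^3. For k < 4 the smaller constant 27 * 2 is enough. *)
Lemma query_lower_bound (R : realType) (n k q : nat) (delta : R) :
  (2 <= n)%N -> (0 < k)%N -> delta < 1 / 4 -> solvable_with n k delta q ->
  504^-1 * (k%:R ^+ 2 * (minn k n)%:R * ln n%:R) <= q%:R :> R.
Proof.
move=> n2 k0 d4 sol.
have n2R : 2 <= n%:R :> R by rewrite ler_nat.
have ln0 : 0 <= ln n%:R :> R by apply: ln_ge0; lra.
have q0 : 0 <= q%:R :> R by [].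
rewrite -ler_pdivlMl ?invrK; last by rewrite invr_gt0; lra.
have [k4|k4] := leqP 4 k; last first.
  have := counting_log_lower_bound n2 k0 d4 sol.
  have kR : k%:R <= 3 :> R by rewrite ler_nat.
  have : (minn k n)%:R <= 3 :> R by rewrite ler_nat geq_min; apply/orP; left.
  move=> mR lq.
  have : k%:R ^+ 2 * (minn k n)%:R <= 27 :> R.
    have -> : 27 = 3 ^+ 2 * 3 :> R by ring.
    by rewrite ler_pM// ?exprn_ge0// lerXn2r// nnegrE.
  by move=> h; have := ler_wpM2r ln0 h; lra.
pose m := minn (k %/ 4) (n %/ 2).
have m0 : (0 < m)%N by rewrite /m; lia.
(* Blocks are as long as possible: m <= n/2 ensures r >= 1, and n < m (r + 2) then gives n <= 3 m
   r. *)
pose r := (n %/ m).-1.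
have nm : (m * (n %/ m) <= n < m * (n %/ m) + m)%N.
  by have := divn_eq n m; have := ltn_pmod n m0; rewrite mulnC; lia.
have nm2 : (2 <= n %/ m)%N by rewrite leq_divRL// /m; lia.
have rE : (n %/ m = r.+1)%N by rewrite /r; lia.
rewrite rE in nm nm2.
have r0 : (0 < r)%N by lia.
have := @block_lower_bound R n m r k q delta m0 r0.
have -> : (m * r.+1 <= n)%N by case/andP: nm.
have -> : (4 * m <= k)%N by rewrite /m; lia.
move=> /(_ isT isT k4 d4 sol) H.
have n3 : (n <= 3 * (m * r))%N by nia.
have mk : (minn k n)%:R <= 7 * m%:R :> R by rewrite -natrM ler_nat /m; lia.
have lnN : ln n%:R <= 3 * ln (1 + (m * r)%:R) :> R.
  have N0 : 0 <= (m * r)%:R :> R by [].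
  have : n%:R <= 3 * (m * r)%:R :> R by rewrite -natrM ler_nat.
  move: (m * r)%:R N0 => N N0 nN.
  have -> : 3 * ln (1 + N) = ln ((1 + N) ^+ 3) by rewrite lnXn ?mulr_natl//; lra.
  rewrite ler_ln ?posrE ?exprn_gt0//; [|lra|lra].
  have -> : (1 + N) ^+ 3 = 1 + 3 * N + (3 * N ^+ 2 + N ^+ 3) by ring.
  have : 0 <= 3 * N ^+ 2 + N ^+ 3 by rewrite addr_ge0 ?mulr_ge0 ?exprn_ge0.
  lra.
have k20 : 0 <= k%:R ^+ 2 :> R by rewrite exprn_ge0.
have : k%:R ^+ 2 * (minn k n)%:R * ln n%:R
    <= k%:R ^+ 2 * (7 * m%:R) * (3 * ln (1 + (m * r)%:R)) :> R.
  by apply: ler_pM => //; exact: ler_wpM2l.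
lra.
Qed.

(** * Upper bound for k <= n *)

Definition failure_prob (R : realType) (n : nat) (S : {mset 'I_n}) (t : strategy n) : R :=
  1 - output_prob R S t S.

(* The query X < s; it is answered without cost when [s = 0] or [s > n]. *)
Definition ask (n : nat) (s : nat) (le gt : strategy n) : strategy n :=
  if s is s'.+1 then if insub s' is Some y then Query y le gt else le else gt.

Arguments ask : simpl never.

Lemma queries_ask (n s : nat) (le gt : strategy n) (q : nat) :
  (queries le <= q)%N -> (queries gt <= q)%N -> (queries (ask s le gt) <= q.+1)%N.
Proof.
move=> h1 h2; rewrite /ask; case: s => [|s]; first exact: leqW.
by case: insubP => [y _ _|_] /=; [rewrite ltnS geq_max h1|exact: leqW].
Qed.

Section FailureProbability.
Variables (R : realType) (n : nat) (S : {mset 'I_n}).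
Hypothesis S0 : (0 < size S)%N.

Lemma failure_prob_ge0 t : 0 <= failure_prob R S t.
Proof. by rewrite subr_ge0 output_prob_le1. Qed.

Lemma failure_prob_le1 t : failure_prob R S t <= 1.
Proof. by rewrite lerBlDr lerDl output_prob_ge0. Qed.

Lemma failure_prob_query y le gt : failure_prob R S (Query y le gt) =
  freq R S y.+1 * failure_prob R S le + (1 - freq R S y.+1) * failure_prob R S gt.
Proof. by rewrite /failure_prob output_prob_query//; ring. Qed.

Lemma failure_prob_ask s le gt : failure_prob R S (ask s le gt) =
  freq R S s * failure_prob R S le + (1 - freq R S s) * failure_prob R S gt.
Proof.
case: s => [|s].
  by rewrite /ask /freq /count_below count_pred0 mul0r mul0r add0r subr0 mul1r.
rewrite /ask; case: insubP => [y _ <-|]; first exact: failure_prob_query.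
rewrite -leqNgt => ns; have -> : freq R S s.+1 = 1.
  rewrite /freq /count_below (_ : count _ _ = size S) ?divff ?pnatr_eq0 -?lt0n//.
  by apply/eqP; rewrite -all_count; apply/allP => i _; rewrite ltnS (leq_trans (ltnW (ltn_ord i))).
by rewrite mul1r subrr mul0r addr0.
Qed.

End FailureProbability.

(** * Weighted median search for one order statistic *)

Section WeightedSearch.
Variable n : nat.
Implicit Types w : 'I_n -> nat.

(** Weights are unnormalised natural numbers: only their ratios matter, and the strategy does not
    depend on the real field. *)
Definition median w : option 'I_n :=
  [pick y : 'I_n | (2 * \sum_(i < n | i < y) w i <= \sum_i w i)%N
                   && (\sum_i w i <= 2 * \sum_(i < n | i <= y) w i)%N].

Definition heavy w : option 'I_n := [pick i | (\sum_i w i < 2 * w i)%N].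

Lemma heavyP w i : (\sum_(j | j != i) w j < w i)%N -> heavy w = Some i.
Proof.
set A := (\sum_(j | _) _)%N => wi.
have tot : (\sum_i w i = w i + A)%N by exact: bigD1.
rewrite /heavy; case: pickP => [j|/(_ i)]; rewrite tot; last by move=> h; lia.
have [->//|ji] := eqVneq j i.
have : (w j <= A)%N by rewrite /A (bigD1 j)//= leq_addr.
by move=> wj h; exfalso; lia.
Qed.

(** Take the least [y] whose closed lower set carries half the weight: either its predecessor fails
    this, or [y] is 0 and the strict sum is empty. *)
Lemma medianP w (i0 : 'I_n) : exists2 y, median w = Some y &
  (2 * \sum_(i < n | i < y) w i <= \sum_i w i)%N
  && (\sum_i w i <= 2 * \sum_(i < n | i <= y) w i)%N.
Proof.
rewrite /median; case: pickP => [y yP|none]; first by exists y.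
exfalso; case: n w i0 none => [|n'] w i0 none; first by case: i0.
pose P (y : 'I_n'.+1) := (\sum_i w i <= 2 * \sum_(i < n'.+1 | i <= y) w i)%N.
have Pmax : P ord_max.
  rewrite /P (_ : \sum_(i < n'.+1 | _) w i = \sum_i w i)%N ?leq_pmull//.
  by apply: eq_bigl => i; exact: leq_ord.
have [y Py ymin] := arg_minnP (fun y : 'I_n'.+1 => y : nat) Pmax.
have /negP := none y; apply; rewrite andbC; apply/andP; split => //.
case: (posnP y) => y0; first by rewrite [X in (2 * X)%N]big_pred0 // => i; rewrite y0.
rewrite leqNgt; apply/negP => h.
have y1n : (y.-1 < n'.+1)%N by have := ltn_ord y; lia.
have := ymin (Ordinal y1n); rewrite /P /= (_ : \sum_(i < n'.+1 | i <= y.-1) w i = \sum_(i < n'.+1 | i < y) w i)%N.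
  by move=> /(_ (ltnW h)); lia.
by apply: eq_bigl => i; rewrite -[in RHS](prednK y0).
Qed.

(** The queries X < y and X <= y together separate [i0] from half of the competing weight: from
    everything at or above [y] if i0 < y, from everything at or below [y] if i0 > y, and from all
    the rest if i0 = y. *)
Lemma median_separates w (i0 y : 'I_n) : 
  (2 * \sum_(i < n | i < y) w i <= \sum_i w i)%N
    && (\sum_i w i <= 2 * \sum_(i < n | i <= y) w i)%N ->
  (\sum_(i | i != i0) w i <= 2 * \sum_(i | i != i0)
     (((i < y) != (i0 < y)) || ((i <= y) != (i0 <= y))) * w i)%N.
Proof.
move=> /andP[lo hi].
set A := (\sum_(i | _) w i)%N.
have tot : (\sum_i w i = w i0 + A)%N by exact: bigD1.
case: (ltngtP i0 y) => [i0y|yi0|/val_inj i0y].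
- have : (\sum_(i < n | ~~ (i < y)) w i <= \sum_(i | i != i0)
     (((i < y) != true) || ((i <= y) != true)) * w i)%N.
    rewrite big_mkcond [leqRHS]big_mkcond; apply: leq_sum => i _.
    by case: (ltnP i y) => //= yi; rewrite ?mul1n; case: eqVneq => // e; move: yi; rewrite e; lia.
  have E : (\sum_i w i = \sum_(i < n | i < y) w i + \sum_(i < n | ~~ (i < y)) w i)%N.
    exact: (bigID (fun i : 'I_n => i < y)%N).
  move=> h; rewrite E mul2n -addnn leq_add2l in lo.
  apply: leq_trans (leq_addl (w i0) A) _; rewrite -tot E mul2n -addnn.
  exact: leq_add (leq_trans lo h) h.
- have : (\sum_(i < n | i <= y) w i <= \sum_(i | i != i0)
     (((i < y) != false) || ((i <= y) != false)) * w i)%N.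
    rewrite big_mkcond [leqRHS]big_mkcond; apply: leq_sum => i _.
    by case: (leqP i y) => //= yi; rewrite ?orbT ?mul1n; case: eqVneq => // e; move: yi; rewrite e; lia.
  move=> h; apply: leq_trans (leq_addl (w i0) A) _.
  by rewrite -tot; apply: leq_trans hi _; rewrite leq_mul2l.
rewrite /A i0y; apply: leq_trans (leq_pmull _ (isT : 0 < 2)%N) _; rewrite leq_mul2l /=; apply/eq_leq/eq_bigr => i; rewrite -val_eqE /= => iy.
by move: iy; case: ltngtP => //= _ _; rewrite mul1n.
Qed.

Variable k : nat.

(* Likelihoods scaled by [4 * k]: with theta = (j + 1/2) / k, the answer X < s
   has probability at least theta + 1/(2k) if [i < s] and at most theta - 1/(2k)
   otherwise; the update assumes only half of this gap, theta +- 1/(4k), which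
   makes the expected odds contract. *)
Definition reweigh (j s : nat) (below : bool) w : 'I_n -> nat := fun i =>
  (w i * if below then if i < s then 4 * j + 3 else 4 * j + 1
         else if i < s then 4 * (k - j) - 3 else 4 * (k - j) - 1)%N.

(* Burnashev-Zigangirov search for the [j]-th smallest element, [j] counted from
   0. Asking on both sides of the weighted median replaces their random choice
   between the two sides. *)
Fixpoint search (j T : nat) w (cont : 'I_n -> strategy n) : strategy n :=
  match T with
  | 0 => if heavy w is Some i then cont i else Output mset0
  | T'.+1 =>
      if median w is Some y then
        let next a b := search j T' (reweigh j y.+1 b (reweigh j y a w)) cont in
        ask y (ask y.+1 (next true true) (next true false))
              (ask y.+1 (next false true) (next false false))
      else Output mset0
  end.

Lemma queries_search j T w cont q : (forall i, queries (cont i) <= q)%N ->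
  (queries (search j T w cont) <= q + 2 * T)%N.
Proof.
move=> cq; elim: T w => [|T IH] w /=.
  by case: heavy => [i|] //=; rewrite muln0 addn0.
case: median => [y|] //=.
have -> : (q + 2 * T.+1 = (q + 2 * T).+2)%N by lia.
by apply: queries_ask; apply: queries_ask; exact: IH.
Qed.

End WeightedSearch.

(** The left side decreases in p. At p = (J + 2) / K it equals 1 - 2 / ((J + 1) (K - J - 1)), and (J
    + 1) (K - J - 1) <= K^2 / 4. *)
Lemma likelihood_contraction (R : realType) (p J K : R) :
  1 < J -> J + 1 < K -> (J + 2) / K <= p -> p <= 1 ->
  p * ((J - 1) / (J + 1)) + (1 - p) * ((K - J + 1) / (K - J - 1)) <= 1 - 8 / K ^+ 2.
Proof.
move=> J1 JK Kp p1.
have K0 : 0 < K by lra.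
have u0 : 0 < J + 1 by lra. have v0 : 0 < K - J - 1 by lra.
have -> : p * ((J - 1) / (J + 1)) + (1 - p) * ((K - J + 1) / (K - J - 1)) =
    1 - 2 * (p / (J + 1) - (1 - p) / (K - J - 1)).
  by field; rewrite !gt_eqF.
have h1 : (J + 2) / K / (J + 1) <= p / (J + 1) by rewrite ler_pM2r ?invr_gt0.
have h2 : (1 - p) / (K - J - 1) <= (1 - (J + 2) / K) / (K - J - 1).
  by rewrite ler_pM2r ?invr_gt0// lerB.
have : 4 / K ^+ 2 <= (J + 2) / K / (J + 1) - (1 - (J + 2) / K) / (K - J - 1).
  have -> : (J + 2) / K / (J + 1) - (1 - (J + 2) / K) / (K - J - 1) =
      1 / ((J + 1) * (K - J - 1)).
    by field; rewrite !gt_eqF.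
  rewrite ler_pdivrMr ?exprn_gt0// mulrAC mul1r ler_pdivlMr ?mulr_gt0//.
  by have := sqr_ge0 (K - 2 * (J + 1)); nra.
lra.
Qed.

Section SearchAnalysis.
Variables (R : realType) (n k j : nat) (S : {mset 'I_n}) (i0 : 'I_n).
Hypotheses (szS : size S = k) (jk : (j < k)%N).
(** This characterises [i0] as the [j]-th smallest element of [S], counted from 0. *)
Hypothesis i0P : forall s, (i0 < s)%N = (j < count_below S s)%N.
Implicit Types w : 'I_n -> nat.

Let S0 : (0 < size S)%N. Proof. by rewrite szS; lia. Qed.
Let gamma : R := 1 / (2 * k%:R ^+ 2).

Let gamma01 : 0 <= gamma <= 1.
Proof.
have k1 : 1 <= k%:R ^+ 2 :> R by rewrite exprn_ege1// ler1n; lia.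
have k2 : 0 < 2 * k%:R ^+ 2 :> R by lra.
rewrite /gamma; apply/andP; split; first by rewrite divr_ge0// ltW.
by rewrite ler_pdivrMr//; lra.
Qed.

Definition odds_against w : R := \sum_(i | i != i0) (w i)%:R / (w i0)%:R.

Lemma reweigh_gt0 s b w i : (0 < w i)%N -> (0 < reweigh k j s b w i)%N.
Proof.
by move=> wi; rewrite /reweigh muln_gt0 wi /=; case: b; case: ifP => _; lia.
Qed.

(** If the query does not separate [i] from [i0], both weights get the same factor. Otherwise the
    contraction applies with J = 4 j + 2 and K = 4 k, for which 8 / K^2 = gamma. *)
Lemma reweigh_ratio s w i : (0 < w i0)%N ->
  freq R S s * ((reweigh k j s true w i)%:R / (reweigh k j s true w i0)%:R)
  + (1 - freq R S s) * ((reweigh k j s false w i)%:R / (reweigh k j s false w i0)%:R)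
  <= (1 - gamma * ((i < s) != (i0 < s))%N%:R) * ((w i)%:R / (w i0)%:R).
Proof.
move=> wi0.
have k1 : 1 <= k%:R :> R by rewrite ler1n; lia.
have jkR : j%:R + 1 <= k%:R :> R by rewrite natr1 ler_nat.
have j0 : 0 <= j%:R :> R by [].
have a3 : (4 * j + 3)%:R = (4 * j%:R + 2) + 1 :> R by rewrite natrD natrM; lra.
have a1 : (4 * j + 1)%:R = (4 * j%:R + 2) - 1 :> R by rewrite natrD natrM; lra.
have b3 : (4 * (k - j) - 3)%:R = 4 * k%:R - (4 * j%:R + 2) - 1 :> R.
  by rewrite natrB ?natrM ?natrB; [lra|lia|lia].
have b1 : (4 * (k - j) - 1)%:R = 4 * k%:R - (4 * j%:R + 2) + 1 :> R.
  by rewrite natrB ?natrM ?natrB; [lra|lia|lia].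
have wR : (w i0)%:R != 0 :> R by rewrite pnatr_eq0; lia.
have g8 : gamma = 8 / (4 * k%:R) ^+ 2 by rewrite /gamma; field; lra.
have v0 : 0 <= (w i)%:R / (w i0)%:R :> R by rewrite divr_ge0.
have fE : freq R S s = (count_below S s)%:R / k%:R by rewrite /freq szS.
have f0 := freq_ge0 R S s; have f1 := freq_le1 R s S0.
rewrite /reweigh !natrM.
have -> (x y p q : R) : x * p / (y * q) = (p / q) * (x / y) by rewrite invfM mulrACA [RHS]mulrC.
have -> (x y p q : R) : x * p / (y * q) = (p / q) * (x / y) by rewrite invfM mulrACA [RHS]mulrC.
rewrite (mulrA (freq R S s)) (mulrA (1 - freq R S s)) -mulrDl; apply: ler_wpM2r => //.
case i0s : (i0 < s)%N; case ils : (i < s)%N => /=; rewrite ?mulr0 ?subr0 ?mulr1.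
- by rewrite !divff ?pnatr_eq0; [lra|lia|lia].
- rewrite a3 a1 b3 b1 g8; apply: likelihood_contraction => //; [lra|lra|].
  rewrite fE; move: i0s; rewrite i0P => i0s.
  have : j%:R + 1 <= (count_below S s)%:R :> R by rewrite natr1 ler_nat.
  by move=> h; rewrite invfM mulrA ler_pM2r ?invr_gt0; lra.
(* Here [i0] lies at or above [s]: the roles of the two answers are exchanged and J becomes K -
   J. *)
- have := @likelihood_contraction R (1 - freq R S s) (4 * k%:R - (4 * j%:R + 2)) (4 * k%:R).
  rewrite a3 a1 b3 b1 g8.
  have -> : 1 - (1 - freq R S s) = freq R S s by lra.
  have -> : 4 * k%:R - (4 * k%:R - (4 * j%:R + 2)) = 4 * j%:R + 2 :> R by lra.
  move=> /(_ ltac:(lra) ltac:(lra)) h; rewrite addrC; apply: h; last by lra.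
  rewrite fE; move/negbT: i0s; rewrite i0P -leqNgt => i0s.
  have : (count_below S s)%:R <= j%:R :> R by rewrite ler_nat.
  move=> h; rewrite ler_pdivrMr; last by lra.
  have -> : (1 - (count_below S s)%:R / k%:R) * (4 * k%:R) = 4 * k%:R - 4 * (count_below S s)%:R :> R.
    by field; lra.
  lra.
- by rewrite !divff ?pnatr_eq0; [lra|lia|lia].
Qed.

Let next w y a b := reweigh k j y.+1 b (reweigh k j y a w).
Let average (p q : R) (f : bool -> bool -> R) : R :=
  p * (q * f true true + (1 - q) * f true false)
  + (1 - p) * (q * f false true + (1 - q) * f false false).

Let average_le p q f g : 0 <= p <= 1 -> 0 <= q <= 1 ->
  (forall a b, f a b <= g a b) -> average p q f <= average p q g.
Proof.
move=> /andP[p0 p1] /andP[q0 q1] fg.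
by rewrite /average lerD// ler_wpM2l ?subr_ge0// lerD// ler_wpM2l// subr_ge0.
Qed.

(** A competitor separated by either query loses a factor 1 - gamma in expectation, and the
    separated competitors hold at least half of the odds. *)
Lemma round_contraction w (y : 'I_n) : (forall i, 0 < w i)%N -> median w = Some y ->
  average (freq R S y) (freq R S y.+1) (fun a b => odds_against (next w y a b))
  <= (1 - gamma / 2) * odds_against w.
Proof.
move=> w0 medy.
have sep : (\sum_(i | i != i0) w i <= 2 * \sum_(i | i != i0)
     (((i < y) != (i0 < y)) || ((i <= y) != (i0 <= y))) * w i)%N.
  by have [y' ] := medianP w i0; rewrite medy => -[<-]; exact: median_separates.
have /andP[g0 g1] := gamma01.
set p := freq R S y; set q := freq R S y.+1.
have p0 : 0 <= p by exact: freq_ge0. have p1 : p <= 1 by exact: freq_le1.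
have q0 : 0 <= q by exact: freq_ge0. have q1 : q <= 1 by exact: freq_le1.
pose v w i : R := (w i)%:R / (w i0)%:R.
have per_i i : average p q (fun a b => v (next w y a b) i) <=
   (1 - gamma * (((i < y) != (i0 < y)) || ((i <= y) != (i0 <= y)))%N%:R) * v w i.
  have v0 : 0 <= v w i by rewrite divr_ge0.
  have h a := reweigh_ratio y.+1 i (reweigh_gt0 y a (w0 i0)).
  have := ler_wpM2l p0 (h true); have := @ler_wpM2l _ (1 - p) ltac:(lra) _ _ (h false).
  have := reweigh_ratio y i (w0 i0); rewrite -/p -/q !ltnS /average /next -/(v _ _).
  rewrite -!/(v _ i).
  set a := v (reweigh k j y true w) i; set b := v (reweigh k j y false w) i.
  move: (v (next w y true true) i) (v (next w y true false) i) => c1 c2.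
  move: (v (next w y false true) i) (v (next w y false false) i) => c3 c4.
  set e1 : bool := (i < y)%N != (i0 < y)%N; set e2 : bool := (i <= y)%N != (i0 <= y)%N.
  move=> h1 h2 h3.
  have e2R : 0 <= 1 - gamma * e2%:R by case: e2 {h2 h3} => /=; lra.
  have := ler_wpM2l e2R h1.
  have : (1 - gamma * e2%:R) * ((1 - gamma * e1%:R) * v w i)
      <= (1 - gamma * (e1 || e2)%:R) * v w i.
    by rewrite mulrA; apply: ler_wpM2r => //; clear h1 h2 h3 e2R; case: e1; case: e2 => /=; nra.
  lra.
rewrite /odds_against /average -/p -/q.
have E : average p q (fun a b => odds_against (next w y a b)) =
    \sum_(i | i != i0) average p q (fun a b => v (next w y a b) i).
  by rewrite /average /odds_against !(big_split, mulr_sumr) /= -?mulr_sumr !big_split/= -?mulr_sumr ?big_split/= -?mulr_sumr.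
move: E; rewrite /average /odds_against => ->.
apply: (le_trans (ler_sum _ (fun i _ => per_i i))).
have -> : \sum_(i | i != i0)
     (1 - gamma * (((i < y) != (i0 < y)) || ((i <= y) != (i0 <= y)))%N%:R) * v w i =
   \sum_(i | i != i0) v w i - gamma * \sum_(i | i != i0)
     (((i < y) != (i0 < y)) || ((i <= y) != (i0 <= y)))%N%:R * v w i.
  by rewrite mulr_sumr -sumrB; apply: eq_bigr => i _; ring.
have : \sum_(i | i != i0) v w i <= 2 * \sum_(i | i != i0)
     (((i < y) != (i0 < y)) || ((i <= y) != (i0 <= y)))%N%:R * v w i.
  rewrite /v -mulr_suml; under [X in 2 * X]eq_bigr do rewrite mulrA.
  rewrite -mulr_suml mulrA ler_pM2r ?invr_gt0 ?ltr0n//.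
  rewrite -natr_sum; under [X in 2 * X]eq_bigr do rewrite -natrM.
  by rewrite -natr_sum -natrM ler_nat.
rewrite /v; set A := \sum_(i | _) _; set B := \sum_(i | _) _; nra.
Qed.

(** Markov's inequality in disguise: at the end, odds below 1 make [heavy] return [i0], and
    otherwise the failure probability is at most 1, hence at most the odds. *)
Lemma search_failure T w (cont : 'I_n -> strategy n) : (forall i, 0 < w i)%N ->
  failure_prob R S (search k j T w cont) <=
  (1 - gamma / 2) ^+ T * odds_against w + failure_prob R S (cont i0).
Proof.
have /andP[g0 g1] := gamma01.
elim: T w => [|T IH] w w0 /=.
  rewrite expr0 mul1r.
  have [lt1|ge1] := ltP (odds_against w) 1.
    rewrite (@heavyP _ w i0); first by rewrite lerDr sumr_ge0// => i _; rewrite divr_ge0.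
    move: lt1; rewrite /odds_against -mulr_suml ltr_pdivrMr ?ltr0n// mul1r.
    by rewrite -natr_sum ltr_nat.
  have h : 0 <= failure_prob R S (cont i0) by exact: failure_prob_ge0.
  by apply: le_trans (failure_prob_le1 R S _) _; lra.
have [y medy _] := medianP w i0; rewrite medy !failure_prob_ask//.
have pw0 a b i : (0 < next w y a b i)%N by do 2 apply: reweigh_gt0.
have p01 s : 0 <= freq R S s <= 1 by rewrite freq_ge0 freq_le1.
have := average_le (p01 y) (p01 y.+1) (fun a b => IH (next w y a b) (pw0 a b)).
rewrite {1}/average => /le_trans; apply.
have := round_contraction w0 medy; rewrite exprSr /average.
have : 0 <= (1 - gamma / 2) ^+ T by rewrite exprn_ge0//; lra.
move: (freq R S y) (freq R S y.+1) => p q.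
set c := _ ^+ T; set F := failure_prob R S (cont i0) => c0 /(ler_wpM2l c0); lra.
Qed.

End SearchAnalysis.

Lemma sorted_nth_ltn (s : seq nat) (j t : nat) : sorted leq s -> (j < size s)%N ->
  (nth 0 s j < t)%N = (j < count (fun x => x < t) s)%N.
Proof.
elim: s j => [|x s IH] [|j] //= ps js; last first.
  rewrite IH ?(path_sorted ps)//.
  case: (ltnP x t) => [_|tx]; first by rewrite add1n ltnS.
  rewrite add0n; have -> : count (fun x => x < t)%N s = 0%N; last by [].
  apply/eqP; rewrite -leqn0 leqNgt -has_count; apply/hasPn => y ys.
  have := order_path_min leq_trans ps => /allP /(_ y ys); lia.
case: (ltnP x t) => [//|tx]; rewrite add0n; apply/esym/negbTE.
rewrite -has_count; apply/hasPn => y ys.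
by have := order_path_min leq_trans ps => /allP /(_ y ys); lia.
Qed.

(** * All order statistics, one after another *)

Section IdentifyBySearch.
Variables (n k T : nat).

Fixpoint search_all (js : seq nat) (found : seq 'I_n) : strategy n :=
  if js is j :: js' then
    search k j T (fun=> 1%N) (fun i => search_all js' (i :: found))
  else Output (seq_mset found).

Lemma queries_search_all js found : (queries (search_all js found) <= size js * (2 * T))%N.
Proof.
elim: js found => [|j js IH] found //=.
by rewrite mulSnr; apply: queries_search.
Qed.

Variables (R : realType) (S : {mset 'I_n}).
Hypotheses (szS : size S = k) (k0 : (0 < k)%N).

(** Union bound over the k searches; uniform initial weights give initial odds at most n. *)
Lemma search_all_failure :
  failure_prob R S (search_all (iota 0 k) [::]) <=
  k%:R * ((1 - 1 / (2 * k%:R ^+ 2) / 2) ^+ T * n%:R).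
Proof.
set eta := _ ^+ T * _.
pose xs := sort (fun i j : 'I_n => i <= j)%N S.
have xsS : perm_eq xs S by rewrite perm_sort.
have szx : size xs = k by rewrite (perm_size xsS).
have S0 : (0 < size S)%N by rewrite szS.
have [x0 _] : exists x0 : 'I_n, x0 \in xs.
  by move: szx; case: xs {xsS} => [|x l] //= szx; [lia|exists x; rewrite mem_head].
have sx : sorted leq (map val xs).
  by rewrite sorted_map; apply: sort_sorted => i j; exact: leq_total.
have k1 : 1 <= k%:R ^+ 2 :> R by rewrite exprn_ege1// ler1n.
have c0 : 0 <= (1 - 1 / (2 * k%:R ^+ 2) / 2) ^+ T :> R.
  apply: exprn_ge0; have : 1 / (2 * k%:R ^+ 2) <= 1 :> R by rewrite ler_pdivrMr; lra.
  lra.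
(* Invariant: the order statistics still to be searched and those already found make up [S]. *)
have main js found : all (fun j => j < k)%N js ->
    perm_eq (rev [seq nth x0 xs j | j <- js] ++ found) S ->
    failure_prob R S (search_all js found) <= (size js)%:R * eta.
  elim: js found => [|j js IH] found /=.
    move=> _ pS; rewrite mul0r /failure_prob/=.
    have -> : seq_mset found = S by rewrite -(seq_mset_id S); apply/eq_seq_msetP.
    by rewrite eqxx subrr.
  move=> /andP[jk jsk]; rewrite rev_cons cat_rcons => pS.
  have target s : (nth x0 xs j < s)%N = (j < count_below S s)%N.
    rewrite /count_below -(permP xsS) -(nth_map _ 0%N) ?szx//.
    by rewrite sorted_nth_ltn ?size_map ?szx// count_map.
  have := search_failure R szS jk target T (w := fun=> 1%N)
    (fun i => search_all js (i :: found)) (fun=> isT).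
  move=> /le_trans; apply; rewrite -[(size js).+1%:R]natr1 (mulrDl _ _ eta) (mul1r eta) addrC.
  apply: lerD; first exact: IH.
  rewrite /eta; apply: ler_wpM2l => //; rewrite /odds_against.
  under eq_bigr do rewrite divr1.
  by rewrite sumr_const ler_nat; apply: leq_trans (max_card _) _; rewrite card_ord.
have := main (iota 0 k) [::]; rewrite size_iota => h; apply: h.
  by apply/allP => j; rewrite mem_iota.
by rewrite cats0 perm_rev -szx map_nth_iota0 // take_size.
Qed.
End IdentifyBySearch.

(** * Upper bound for k >= n *)

Section Hoeffding.
Variables (R : realType) (n k T : nat).

(** Rounding of the empirical frequency: |N/T - c/k| < 1/(2k), cleared of denominators. *)
Definition decode (N : nat) : option 'I_k.+1 :=
  [pick c : 'I_k.+1 | (2 * `|(k * N)%:Z - (T * c)%:Z| < T)%N].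

Fixpoint sample (y : 'I_n) (t N : nat) (cont : nat -> strategy n) : strategy n :=
  if t is t'.+1 then Query y (sample y t' N.+1 cont) (sample y t' N cont)
  else if decode N is Some c then cont c else Output mset0.

Lemma queries_sample y t N cont q : (forall c, queries (cont c) <= q)%N ->
  (queries (sample y t N cont) <= t + q)%N.
Proof.
move=> cq; elim: t N => [|t IH] N /=; first by case: decode => //= c.
by rewrite addSn ltnS geq_max !IH.
Qed.

(** From e^(-x) >= 1 - x follows e^x <= 1 / (1 - x), and (1 - x) (1 + x + 2 x^2) >= 1 for x <=
    1/2. *)
Lemma expR_le_quadratic (x : R) : -(1 / 2) <= x <= 1 / 2 -> expR x <= 1 + x + 2 * x ^+ 2.
Proof.
move=> /andP[x1 x2]; have := expR_ge1Dx (- x).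
rewrite expRN -[X in _ <= X -> _]div1r ler_pdivlMr ?expR_gt0// => h.
have e0 := expR_gt0 x; have x20 := sqr_ge0 x.
have : (1 - x) * (1 + x + 2 * x ^+ 2) = 1 + x ^+ 2 * (1 - 2 * x) by ring.
have : 0 <= x ^+ 2 * (1 - 2 * x) by apply: mulr_ge0 => //; lra.
have : 0 < 1 - x by lra.
nra.
Qed.

(** The linear terms cancel in the mean and leave 1 + 2 p (1 - p) l^2. *)
Lemma bernoulli_mgf (p l : R) : 0 <= p <= 1 -> -(1 / 2) <= l <= 1 / 2 ->
  p * expR (l * (1 - p)) + (1 - p) * expR (- (l * p)) <= expR (l ^+ 2).
Proof.
move=> /andP[p0 p1] /andP[l1 l2].
have h1 := @expR_le_quadratic (l * (1 - p)) ltac:(apply/andP; split; nra).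
have h2 := @expR_le_quadratic (- (l * p)) ltac:(apply/andP; split; nra).
have g1 := ler_wpM2l p0 h1.
have g2 := @ler_wpM2l _ (1 - p) ltac:(lra) _ _ h2.
apply: le_trans (expR_ge1Dx _); apply: (le_trans (lerD g1 g2)).
have -> : p * (1 + l * (1 - p) + 2 * (l * (1 - p)) ^+ 2)
   + (1 - p) * (1 + - (l * p) + 2 * (- (l * p)) ^+ 2) = 1 + l ^+ 2 * (2 * (p * (1 - p))) by ring.
have : 2 * (p * (1 - p)) <= 1 by have := sqr_ge0 (1 - 2 * p); nra.
by move=> /(ler_wpM2l (sqr_ge0 l)); lra.
Qed.

Variable (S : {mset 'I_n}).
Hypotheses (szS : size S = k) (k0 : (0 < k)%N).
Let S0 : (0 < size S)%N. Proof. by rewrite szS. Qed.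

(** Two-sided Chernoff bound by induction on the [t] samples left, after [s] samples with [N]
    answers X <= y. The moment bound at l and at -l pays for each sample. *)
Lemma sample_failure_aux (y : 'I_n) (t N : nat) (l : R) (cont : nat -> strategy n) (s : nat) (p := freq R S y.+1) :
  (t + s = T)%N -> 0 <= l <= 1 / 2 -> 
  failure_prob R S (sample y t N cont) <=
  expR (l ^+ 2 * t%:R) * expR (- (l * T%:R / (2 * k%:R)))
    * (expR (l * (N%:R - s%:R * p)) + expR (- (l * (N%:R - s%:R * p))))
  + failure_prob R S (cont (count_below S y.+1)).
Proof.
move=> + /andP[l0 l1].
have p0 : 0 <= p := freq_ge0 R S y.+1. have p1 : p <= 1 by exact: freq_le1.
have kR : 0 < k%:R :> R by rewrite ltr0n.
have pk : p * k%:R = (count_below S y.+1)%:R by rewrite /p /freq szS divfK// gt_eqF.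
elim: t N s => [|t IH] N s /=; last first.
  rewrite addSnnS => ts; rewrite failure_prob_query// -/p.
  have := ler_wpM2l p0 (IH N.+1 s.+1 ts).
  have := @ler_wpM2l _ (1 - p) ltac:(lra) _ _ (IH N s.+1 ts).
  have m1 := @bernoulli_mgf p l ltac:(apply/andP; lra) ltac:(apply/andP; lra).
  have m2 := @bernoulli_mgf p (- l) ltac:(apply/andP; lra) ltac:(apply/andP; lra).
  set F := failure_prob R S (cont _).
  set c := expR (- (l * T%:R / _)).
  have -> : l * (N.+1%:R - s.+1%:R * p) = l * (N%:R - s%:R * p) + l * (1 - p).
    by rewrite -natr1 -[s.+1%:R]natr1; ring.
  have -> : l * (N%:R - s.+1%:R * p) = l * (N%:R - s%:R * p) + - (l * p).
    by rewrite -[s.+1%:R]natr1; ring.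
  have -> : l ^+ 2 * t.+1%:R = l ^+ 2 * t%:R + l ^+ 2 by rewrite -natr1; ring.
  move: m2; rewrite sqrrN !mulNr opprK => m2.
  rewrite !opprD opprK !expRD.
  set E := expR (l * (N%:R - _)); set E' := expR (- (l * (N%:R - _))).
  set q := expR (l ^+ 2 * t%:R); set b := expR (l ^+ 2) in m1 m2 *.
  set a1 := expR (l * (1 - p)) in m1 *; set a2 := expR (- (l * (1 - p))) in m2 *.
  set a3 := expR (- (l * p)) in m1 *; set a4 := expR (l * p) in m2 *.
  have Q0 : 0 <= q * c * E by rewrite !mulr_ge0// expR_ge0.
  have Q1 : 0 <= q * c * E' by rewrite !mulr_ge0// expR_ge0.
  have := ler_wpM2l Q0 m1; have := ler_wpM2l Q1 m2; lra.
rewrite add0n => ->.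
have e1 : 0 <= expR (- (l * T%:R / (2 * k%:R))) by exact: expR_ge0.
rewrite mulr0 expR0 mul1r.
set c := count_below S y.+1.
have ck : (c < k.+1)%N by rewrite ltnS -szS count_size.
have [close|far] := boolP (2 * `|(k * N)%:Z - (T * c)%:Z| < T)%N.
  have -> : decode N = Some (Ordinal ck).
    rewrite /decode; case: pickP => [c' c'P|/(_ (Ordinal ck))/=]; last by rewrite close.
    congr Some; apply/val_inj => /=; apply/eqP; rewrite eqn_leq.
    (* Both T c and T c' are within T/2 of k N, strictly, so c = c'. *)
    by apply/andP; split; rewrite leqNgt; apply/negP => h; nia.
  by rewrite lerDr mulr_ge0// addr_ge0// expR_ge0.
have h : 0 <= failure_prob R S (cont c) by exact: failure_prob_ge0.
apply: le_trans (failure_prob_le1 R S _) _.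
suff : 1 <= expR (- (l * T%:R / (2 * k%:R))) *
  (expR (l * (N%:R - T%:R * p)) + expR (- (l * (N%:R - T%:R * p)))) by lra.
rewrite mulrDr -!expRD.
(* Rounding failed, so the centred count is off by at least T/(2k) to one side, and the exponential
   for that side already makes the bound at least 1. *)
have fE : T%:R / (2 * k%:R) <= N%:R - T%:R * p \/ T%:R / (2 * k%:R) <= - (N%:R - T%:R * p).
  have : (T + 2 * (T * c) <= 2 * (k * N) \/ T + 2 * (k * N) <= 2 * (T * c))%N by lia.
  rewrite !ler_pdivrMr ?mulr_gt0//.
  have E1 : T%:R * p * k%:R = T%:R * c%:R by rewrite -mulrA pk.
  case=> hh; [left|right]; move: hh; rewrite -(ler_nat R) !natrD !natrM -E1 => hh; nra.
case: fE => /(ler_wpM2l l0) fE.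
  apply: le_trans (_ : _ <= expR (- (l * T%:R / (2 * k%:R)) + l * (N%:R - T%:R * p))) _.
    by rewrite -[leLHS]expR0 ler_expR; lra.
  by rewrite lerDl expR_ge0.
apply: le_trans (_ : _ <= expR (- (l * T%:R / (2 * k%:R)) - l * (N%:R - T%:R * p))) _.
  by rewrite -[leLHS]expR0 ler_expR; lra.
by rewrite lerDr expR_ge0.
Qed.

End Hoeffding.

(** * Recovery of the multiset from its cumulative counts *)

Section IdentifyBySampling.
Variables (n k T : nat).

Lemma count_below_inj (S U : {mset 'I_n}) :
  (forall i : 'I_n, count_below S i.+1 = count_below U i.+1) -> S = U.
Proof.
move=> SU.
have E s : (s <= n)%N -> count_below S s = count_below U s.
  case: s => [|s] sn; first by rewrite /count_below !count_pred0.
  exact: (SU (Ordinal sn)).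
have mult (V : {mset 'I_n}) (i : 'I_n) : (count_below V i.+1 = count_below V i + V i)%N.
  rewrite -count_mem_mset /count_below -count_predUI addnC.
  rewrite [X in (X + _)%N](_ : _ = 0%N) ?add0n.
    by apply: eq_count => j /=; rewrite ltnS leq_eqVlt orbC.
  by rewrite -(count_pred0 V); apply: eq_count => j /=; apply/negP => /andP[h /eqP e]; move: h; rewrite e ltnn.
apply/msetP => i; have := mult S i; rewrite SU mult (E i) ?(ltnW (ltn_ord i))//.
by move/addnI.
Qed.

(** The estimated counts are inverted by [xget]; the default [mset0] is output when no multiset has
    these counts. *)
Fixpoint sample_all (ys : seq 'I_n) (c : 'I_n -> nat) : strategy n :=
  if ys is y :: ys' then
    sample k T y T 0 (fun v => sample_all ys' (fun i => if i == y then v else c i))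
  else Output (xget mset0 [set U | forall i : 'I_n, count_below U i.+1 = c i]).

Lemma queries_sample_all ys c : (queries (sample_all ys c) <= size ys * T)%N.
Proof.
by elim: ys c => [|y ys IH] c //=; rewrite mulSn; apply: queries_sample.
Qed.

Variables (R : realType) (S : {mset 'I_n}).
Hypotheses (szS : size S = k) (k0 : (0 < k)%N).

Lemma sample_failure (y : 'I_n) (cont : nat -> strategy n) :
  failure_prob R S (sample k T y T 0 cont) <=
  2 * expR (- (T%:R / (16 * k%:R ^+ 2))) + failure_prob R S (cont (count_below S y.+1)).
Proof.
have k1 : 1 <= k%:R :> R by rewrite ler1n.
(* The value l = 1/(4k) minimises l^2 T - l T / (2k). *)
have l01 : 0 <= (1 / (4 * k%:R) : R) <= 1 / 2.
  by apply/andP; split; [rewrite divr_ge0//; lra|rewrite ler_pdivrMr; lra].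
have := sample_failure_aux szS k0 y 0 cont (addn0 T) l01.
rewrite mul0r subr0 mulr0 oppr0 expR0 -expRD.
have -> : (1 / (4 * k%:R)) ^+ 2 * T%:R + - (1 / (4 * k%:R) * T%:R / (2 * k%:R)) =
   - (T%:R / (16 * k%:R ^+ 2)) :> R by field; lra.
by rewrite -[1 + 1]/(2%:R) [_ * 2]mulrC.
Qed.

Lemma sample_all_failure :
  failure_prob R S (sample_all (enum 'I_n) (fun=> 0%N)) <=
  n%:R * (2 * expR (- (T%:R / (16 * k%:R ^+ 2)))).
Proof.
set eta := 2 * _.
(* Invariant: outside the remaining values [ys] the recorded counts are exact. For the full list
   this is vacuous. *)
have main (ys : seq 'I_n) (c : 'I_n -> nat) : (forall i, i \notin ys -> c i = count_below S i.+1) ->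
    failure_prob R S (sample_all ys c) <= (size ys)%:R * eta.
  elim: ys c => [|y ys IH] c cP /=.
    rewrite mul0r /failure_prob /=; case: xgetP => [U _ UP|/(_ S)].
      have -> : U = S by apply: count_below_inj => i; rewrite UP cP.
      by rewrite eqxx subrr.
    by case=> i; rewrite cP.
  apply: le_trans (sample_failure _ _) _.
  rewrite -[(size ys).+1%:R]natr1 (mulrDl _ _ eta) (mul1r eta) addrC.
  apply: lerD => //; apply: IH => i iys; case: eqVneq => [->//|iy].
  by rewrite cP// inE negb_or iy.
by have := main (enum 'I_n) (fun=> 0%N); rewrite size_enum_ord; apply=> i; rewrite mem_enum.
Qed.

End IdentifyBySampling.

(** * Choice of the sample sizes and final bounds *)

Lemma query_upper_bound (R : realType) (beta : R) (n k : nat) (delta : R) :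
  0 < beta -> (2 <= n)%N -> (0 < k)%N -> n%:R `^ (- beta) <= delta ->
  exists2 q, solvable_with n k delta q &
    q%:R <= (34 + 16 * beta) * (k%:R ^+ 2 * (minn k n)%:R * ln n%:R).
Proof.
move=> b0 n2 k0 nd.
have n2R : 2 <= n%:R :> R by rewrite ler_nat.
have k1 : 1 <= k%:R :> R by rewrite ler1n.
have k2 : 1 <= k%:R ^+ 2 :> R by rewrite exprn_ege1.
have n0 : n%:R != 0 :> R by rewrite gt_eqF//; lra.
set L := ln n%:R.
have L2 : 1 / 2 <= L.
  have := @ln_ge1BV R 2 ltac:(lra); have : ln 2 <= L by rewrite ler_ln ?posrE; lra.
  lra.
(* One factor n pays for the union bound, the other for the initial odds n when k <= n, or for the
   two tails when k > n. *)
have nb : expR (- ((2 + beta) * L)) * (n%:R * n%:R) <= delta.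
  apply: le_trans nd; rewrite /powR (negbTE n0) -/L.
  have -> : n%:R = expR L by rewrite lnK// posrE; lra.
  by rewrite -!expRD ler_expR; lra.
have b20 : 0 < (2 + beta) * L by apply: mulr_gt0; lra.
have trunc_bound (a : R) : 0 <= a -> exists2 T : nat, a <= T%:R & T%:R <= a + 1.
  move=> a0; exists (Num.truncn a).+1; have /andP[lo hi] := truncn_itv a0; first exact: ltW.
  by rewrite -natr1 lerD2r.
have [kn|nk] := leqP k n.
  have [|T Tlo Thi] := trunc_bound (4 * k%:R ^+ 2 * ((2 + beta) * L)).
    by apply: mulr_ge0; [apply: mulr_ge0; lra|exact: ltW].
  exists (queries (search_all k T (iota 0 k) (Nil 'I_n))).
    apply: deterministic_solvable => S szS.
    apply: le_trans (search_all_failure T R szS k0) _; apply: le_trans nb.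
    have kn' : k%:R <= n%:R :> R by rewrite ler_nat.
    have c0 : 0 <= 1 - 1 / (2 * k%:R ^+ 2) / 2 :> R.
      have : 1 / (2 * k%:R ^+ 2) <= 1 :> R by rewrite ler_pdivrMr; lra.
      lra.
    have : (1 - 1 / (2 * k%:R ^+ 2) / 2) ^+ T <= expR (- ((2 + beta) * L)) :> R.
      apply: le_trans (_ : expR (- (1 / (2 * k%:R ^+ 2) / 2)) ^+ T <= _).
        rewrite lerXn2r ?nnegrE ?expR_ge0//; exact: expR_ge1Dx.
      rewrite -expRM_natl ler_expR mulrN lerN2.
      have -> : T%:R * (1 / (2 * k%:R ^+ 2) / 2) = T%:R / (4 * k%:R ^+ 2) :> R by field; lra.
      by rewrite ler_pdivlMr; lra.
    set e := expR _; set c := _ ^+ T => ce.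
    have e0 : 0 <= e by exact: expR_ge0.
    have cT : 0 <= c by exact: exprn_ge0.
    have : c * n%:R <= e * n%:R by rewrite ler_wpM2r.
    have : k%:R * (c * n%:R) <= n%:R * (c * n%:R) by rewrite ler_wpM2r// mulr_ge0.
    have : n%:R * (c * n%:R) <= n%:R * (e * n%:R) by rewrite ler_wpM2l// ler_wpM2r.
    lra.
  have : (queries (search_all k T (iota 0 k) (Nil 'I_n)))%:R <= k%:R * (2 * T%:R) :> R.
    rewrite -!natrM ler_nat; have := @queries_search_all n k T (iota 0 k) [::].
    by rewrite size_iota.
  move=> /le_trans; apply.
  have : 1 <= 2 * (k%:R ^+ 2 * L) by nra.
  set X := k%:R ^+ 2 * L => X1.
  (* 10 = 4 * 2 + 2: rounding T up costs at most 1 <= 2 X. *)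
  have T2 : T%:R <= (10 + 4 * beta) * X by move: Thi X1; rewrite /X; lra.
  have -> : k%:R ^+ 2 * k%:R * L = k%:R * X by rewrite /X; ring.
  have : k%:R * (2 * T%:R) <= k%:R * (2 * ((10 + 4 * beta) * X)).
    by rewrite ler_wpM2l// ler_wpM2l.
  have : 0 <= k%:R * X by apply: mulr_ge0; lra.
  have : 0 <= beta * (k%:R * X) by apply: mulr_ge0; [lra|apply: mulr_ge0; lra].
  lra.
have [|T Tlo Thi] := trunc_bound (16 * k%:R ^+ 2 * ((2 + beta) * L)).
  by apply: mulr_ge0; [apply: mulr_ge0; lra|exact: ltW].
exists (queries (sample_all k T (enum 'I_n) (fun=> 0%N))).
  apply: deterministic_solvable => S szS.
  apply: le_trans (sample_all_failure T R szS k0) _; apply: le_trans nb.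
  have : expR (- (T%:R / (16 * k%:R ^+ 2))) <= expR (- ((2 + beta) * L)) :> R.
    by rewrite ler_expR lerN2 ler_pdivlMr; lra.
  set e := expR _; set e' := expR _ => ee.
  have e0 : 0 <= e by exact: expR_ge0.
  have : n%:R * (2 * e) <= n%:R * (n%:R * e) by rewrite ler_wpM2l// ler_wpM2r.
  have : n%:R * (n%:R * e) <= n%:R * (n%:R * e') by rewrite ler_wpM2l// ler_wpM2l.
  lra.
have : (queries (sample_all k T (enum 'I_n) (fun=> 0%N)))%:R <= n%:R * T%:R :> R.
  rewrite -!natrM ler_nat; have := queries_sample_all k T (enum 'I_n) (fun=> 0%N).
  by rewrite size_enum_ord.
move=> /le_trans; apply.
have : 1 <= 2 * (k%:R ^+ 2 * L) by nra.
set X := k%:R ^+ 2 * L => X1.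
(* 34 = 16 * 2 + 2, again with 1 <= 2 X for the rounding. *)
have T2 : T%:R <= (34 + 16 * beta) * X by move: Thi X1; rewrite /X; lra.
have -> : k%:R ^+ 2 * n%:R * L = n%:R * X by rewrite /X; ring.
have : n%:R * T%:R <= n%:R * ((34 + 16 * beta) * X) by rewrite ler_wpM2l.
lra.
Qed.

Theorem theorem1 (R : realType) (beta : R) (beta_gt0 : 0 < beta) :
  exists c C : R, 0 < c /\ 0 < C /\
    forall (n k : nat) (delta : R),
      (0 < n)%N -> (0 < k)%N ->
      n%:R `^ (- beta) <= delta -> delta < 1 / 4 ->
      exists q : nat, is_query_complexity n k delta q /\
        ((k <= n)%N ->
           c * (k%:R ^+ 3 * ln n%:R) <= q%:R <= C * (k%:R ^+ 3 * ln n%:R)) /\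
        ((n <= k)%N ->
           c * (k%:R ^+ 2 * n%:R * ln n%:R) <= q%:R
             <= C * (k%:R ^+ 2 * n%:R * ln n%:R)).
Proof.
exists 504^-1, (34 + 16 * beta); split; first by rewrite invr_gt0.
split; first by lra.
move=> n k delta n0 k0 nd d4.
(* For n = 1 the power of n is 1, contradicting delta < 1/4. *)
have n2 : (2 <= n)%N.
  case: n n0 nd => [|[|n]] //= _; rewrite powR1; lra.
have [q0 sol0 up] := query_upper_bound beta_gt0 n2 k0 nd.
have [q qP qq0] := is_query_complexity_exists sol0.
have lo := query_lower_bound n2 k0 d4 qP.1.
have {}up : q%:R <= (34 + 16 * beta) * (k%:R ^+ 2 * (minn k n)%:R * ln n%:R).
  by apply: le_trans up; rewrite ler_nat.
exists q; split => //; split => [kn|nk].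
  by move: lo up; rewrite (minn_idPl kn) -exprSr => -> ->.
by move: lo up; rewrite (minn_idPr nk) => -> ->.
Qed.
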